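(* There is only one equivalence class of $1$-perfect ternary codes of length $13$ with kernel of dimension $9$.
   Context: The Hamming graph $H(13,3)$ has vertex set $\mathbb{F}_3^{13}$, two words being adjacent iff they differ in exactly one position. A $1$-perfect code is a set of pairwise non-adjacent vertices such that every vertex not in the set is adjacent to exactly one element of the set. The kernel of a code $C\subset\mathbb{F}_3^n$ is the linear subspace $\{\bar x\in\mathbb{F}_3^n:\ \bar x+C=C\}$. Two codes are equivalent if some automorphism of $H(13,3)$ (composition of a coordinate permutation and independent permutations of the alphabet $\{0,1,2\}$ in each coordinate) sends one to the other. *)

(* Defs.v *)
From mathcomp Require Import all_boot all_order all_algebra all_fingroup.
Set Implicit Arguments.
Unset Strict Implicit.
Unset Printing Implicit Defensive.
Import GRing.Theory.
Local Open Scope ring_scope.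

Notation word n := 'rV['F_3]_n.
Notation code n := {set 'rV['F_3]_n}.

Definition hamming_adj n (x y : word n) : bool :=
  #|[set i | x 0 i != y 0 i]| == 1%N.

Definition perfect_code n (C : code n) : Prop :=
  {in C &, forall x y, ~~ hamming_adj x y} /\
  (forall x, x \notin C -> #|[set y in C | hamming_adj x y]| = 1%N).

Definition kernel_set n (C : code n) : {set word n} :=
  [set x | [set x + c | c in C] == C].

(* [kernel_set C] is already closed under linear combinations, so that taking
   the span adds no element: see [mem_code_kernel]. *)
Definition code_kernel n (C : code n) : {vspace word n} :=
  <<enum (kernel_set C)>>%VS.

Lemma kernel_set0 n (C : code n) : 0 \in kernel_set C.
Proof.
rewrite inE; apply/eqP; rewrite -[RHS]imset_id.
by apply: eq_imset => c; rewrite add0r.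
Qed.

Lemma kernel_setD n (C : code n) x y :
  x \in kernel_set C -> y \in kernel_set C -> x + y \in kernel_set C.
Proof.
rewrite !inE => /eqP Cx /eqP Cy; apply/eqP; rewrite -[RHS]Cx -{2}Cy -imset_comp.
by apply: eq_imset => c /=; rewrite addrA.
Qed.

Lemma kernel_setZ n (C : code n) (a : 'F_3) x :
  x \in kernel_set C -> a *: x \in kernel_set C.
Proof.
move=> Cx; rewrite -[a]natr_Zp scaler_nat.
elim: (nat_of_ord a) => [|k IHk]; first by rewrite mulr0n kernel_set0.
by rewrite mulrS kernel_setD.
Qed.

Lemma mem_code_kernel n (C : code n) x :
  (x \in code_kernel C) = (x \in kernel_set C).
Proof.
apply/idP/idP => [/coord_span ->|Cx]; last first.
  by apply: memv_span; rewrite mem_enum.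
apply: (big_ind (fun v => v \in kernel_set C)) => [|u v|i _].
- exact: kernel_set0.
- exact: kernel_setD.
- by apply: kernel_setZ; rewrite -mem_enum; apply: mem_nth; rewrite size_tuple.
Qed.

Definition hamming_aut n (s : 'S_n) (p : 'I_n -> {perm 'F_3}) (x : word n) :
  word n := \row_i p i (x 0 (s i)).

Lemma hamming_aut_adj n (s : 'S_n) (p : 'I_n -> {perm 'F_3}) (x y : word n) :
  hamming_adj (hamming_aut s p x) (hamming_aut s p y) = hamming_adj x y.
Proof.
rewrite /hamming_adj; congr (_ == _).
rewrite -[RHS](card_preimset _ (@perm_inj _ s)).
by apply: eq_card => i; rewrite [LHS]inE [RHS]inE inE !mxE (inj_eq perm_inj).
Qed.

Definition code_equiv n (C D : code n) : Prop :=
  exists (s : 'S_n) (p : 'I_n -> {perm 'F_3}), hamming_aut s p @: C = D.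

(* Main.v *)
(* A perfect code C with kernel of dimension 9 is the preimage of a set S under
   a linear surjection f from F_3^13 to V = F_3^4 with the kernel of C as
   kernel. Perfectness says that S and the set E of the 27 values of f at the
   words of weight at most 1 tile V: every vector is s + e in a unique way. So
   S = {t, t+a, t+b}, and a, b are independent, as otherwise S would be
   periodic. The only differences that E can have in the plane <a, b> are
   +-(a+b), which forces E to be invariant under a+b; hence, in suitable
   coordinates (x, y, c, z), E is the surface c = w(x, y) for a function w, odd
   because E = -E, and not linear because E spans V. Every odd function on F_3^2
   is a binary cubic p x^2 y + q x y^2 plus a linear form, and every nonzero
   such cubic is x^2 y up to a linear substitution and a linear form. Thus S (up
   to translation) and E do not depend on C. Finally, f is determined by E up to
   a permutation and signs of the coordinates. *)
Require Import Defs.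
From HB Require Import structures.
From mathcomp Require Import all_boot all_order all_algebra all_fingroup.
From mathcomp Require Import ring.
Set Implicit Arguments.
Unset Strict Implicit.
Unset Printing Implicit Defensive.
Import GRing.Theory.
Local Open Scope ring_scope.

(** * Arithmetic of the field with three elements *)

Lemma F3P (x : 'F_3) : [\/ x = 0, x = 1 | x = -1].
Proof.
suff: [|| x == 0, x == 1 | x == -1] by case/or3P=> /eqP->; constructor.
by case: x; do 3?case=> //.
Qed.

Lemma F3_sign (x : 'F_3) : x != 0 -> exists b : bool, x = (-1) ^+ b.
Proof.
by case: (F3P x) => -> // _; [exists false | exists true].
Qed.

Lemma signr_F3_inj : injective (fun b : bool => (-1) ^+ b : 'F_3).
Proof. by case=> [] [] // /eqP. Qed.

Lemma signr_F3_neq0 (b : bool) : (-1) ^+ b != 0 :> 'F_3.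
Proof. by case: b. Qed.

(** * Linear maps prescribed on bases *)

Section LinearExtension.

Variables (K : fieldType) (U W : vectType K).

(** Send a basis of [L] to 0 and a basis of a complement of [L] to a basis of [W]; rank-nullity then
    leaves no room for a kernel larger than [L]. *)
Lemma hom_with_kernel (L : {vspace U}) :
    \dim {:U} = (\dim L + \dim {:W})%N ->
  exists f : 'Hom(U, W), lker f = L /\ limg f = fullv.
Proof.
move=> dimU; pose X : seq U := vbasis L ++ vbasis (L^C)%VS.
pose Y : seq W := nseq (\dim L) 0 ++ vbasis {:W}.
have dimLC : \dim (L^C)%VS = \dim {:W} by rewrite dimv_compl dimU addKn.
have freeX : free X.
  rewrite cat_free !(basis_free (vbasisP _)) /= !(span_basis (vbasisP _)).
  by apply/directv_addP; rewrite capv_compl.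
have [g gXY] := linear_of_free X Y.
have {gXY} := gXY freeX; rewrite !size_cat size_nseq !size_tuple dimLC.
move=> /(_ erefl) gXY; pose f := linfun g.
have mapf (s : seq U) : map f s = map g s by apply: eq_map => v; rewrite lfunE.
move/eqP: gXY; rewrite map_cat eqseq_cat ?size_map ?size_tuple ?size_nseq //.
rewrite -!mapf => /andP[/eqP fL /eqP fLC].
have limgf : limg f = fullv.
  apply/eqP; rewrite eqEsubv subvf -(span_basis (vbasisP {:W})) -fLC.
  by rewrite -limg_span limgS ?subvf.
exists f; split=> //; apply/esym/eqP; rewrite eqEdim; apply/andP; split.
  rewrite -(span_basis (vbasisP L)); apply/span_subvP => v vL.
  have : f v \in nseq (\dim L) 0 by rewrite -fL map_f.
  by rewrite mem_nseq memv_ker => /andP[_].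
by rewrite -(leq_add2r (\dim {:W})) -dimU -limgf -(limg_ker_dim f fullv) capfv.
Qed.

(** Both families are completed to bases by bases of complements. The map between these bases is
    onto, hence injective by rank-nullity. *)
Lemma end_of_free (X Y : seq U) :
    free X -> free Y -> size X = size Y ->
  exists2 g : 'End(U), map g X = Y & injective g.
Proof.
move=> freeX freeY szXY.
have compl (s : seq U) : free s -> basis_of fullv (s ++ vbasis <<s>>^C%VS).
  move=> free_s; rewrite -(addv_complf <<s>>) cat_basis ?vbasisP //.
    by apply/directv_addP; rewrite capv_compl.
  by rewrite /basis_of eqxx free_s.
have size_compl (s : seq U) : free s ->
    size (s ++ vbasis <<s>>^C%VS) = \dim {:U}.
  by move/compl/andP=> [/eqP defU /eqP <-]; rewrite defU.
have [g gXY] :=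
  linear_of_free (X ++ vbasis <<X>>^C%VS) (Y ++ vbasis <<Y>>^C%VS).
have {}gXY := gXY (basis_free (compl _ freeX))
  (etrans (size_compl _ freeY) (esym (size_compl _ freeX))).
have mapg (s : seq U) : map (linfun g) s = map g s.
  by apply: eq_map => v; rewrite lfunE.
exists (linfun g).
  move/eqP: gXY; rewrite map_cat eqseq_cat ?size_map // => /andP[/eqP + _].
  by rewrite mapg.
apply/lker0P; rewrite -dimv_eq0 -(eqn_add2r (\dim (limg (linfun g)))).
rewrite add0n -{1}(capfv (lker _)) limg_ker_dim eqn_leq.
rewrite [X in _ && X]dimvS ?subvf //.
by rewrite andbT -{1}(span_basis (compl _ freeY)) -gXY -mapg -limg_span
           dimvS // limgS ?subvf.
Qed.

End LinearExtension.

(** * Perfect codes as tilings *)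

Section ErrorPatterns.

Variable n : nat.

(** Indexes the words of weight at most 1 without repetition, [None] standing for the zero word, so
    that a ball of radius 1 is [x + error e] with [e] ranging over a type of size 2n + 1. *)
Definition error (e : option ('I_n * bool)) : word n :=
  if e is Some (i, b) then (-1) ^+ b *: delta_mx 0 i else 0.

Lemma error_inj : injective error.
Proof.
have error_neq0 jb : error (Some jb) != 0.
  case: jb => j b; apply/eqP => /rowP/(_ j); rewrite !mxE !eqxx mulr1.
  by apply/eqP/signr_F3_neq0.
case=> [[i b]|] [[j c]|] //; last 2 first.
- by move/eqP; rewrite (negPf (error_neq0 _)).
- by move/esym/eqP; rewrite (negPf (error_neq0 _)).
move/rowP/(_ i); rewrite !mxE !eqxx /= mulr1.
have [<-|_] := eqVneq i j; first by rewrite mulr1 => /signr_F3_inj <-.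
by rewrite mulr0 => /eqP; rewrite (negPf (signr_F3_neq0 _)).
Qed.

Lemma errorN e : exists e', error e' = - error e.
Proof.
case: e => [[i b]|]; last by exists None; rewrite oppr0.
by exists (Some (i, ~~ b)); rewrite /= signrN scaleNr.
Qed.

Lemma hamming_adjP (x y : word n) :
  reflect (exists ib, y = x + error (Some ib)) (hamming_adj x y).
Proof.
apply: (iffP cards1P) => [[i xy]|[[i b] ->]].
  have neq j : (x 0 j != y 0 j) = (j == i) by move/setP/(_ j): xy; rewrite !inE.
  have [|b yx] := @F3_sign (y 0 i - x 0 i).
    by rewrite subr_eq0 eq_sym neq.
  exists (i, b); apply/rowP => j; rewrite !mxE -yx.
  have [->|ji] := eqVneq j i; first by rewrite eqxx mulr1 addrC subrK.
  by rewrite mulr0 addr0; apply/esym/eqP; rewrite -[_ == _]negbK neq.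
exists i; apply/setP => j; rewrite !inE !mxE -subr_eq0 opprD addrA subrr add0r.
by rewrite oppr_eq0 mulf_eq0 (negPf (signr_F3_neq0 b)) /=; case: (j == i).
Qed.

(** Both clauses of perfectness merge into one: each ball of radius 1 contains exactly one codeword.
    The index [None] accounts for centres lying in [C]. *)
Lemma perfect_codeP (C : code n) :
  perfect_code C <-> forall x, exists! e, x + error e \in C.
Proof.
split=> [[Cind Cdom] x|tile].
  have [xC|xC] := boolP (x \in C).
    exists None; split=> [|[ib|] //]; first by rewrite addr0.
    move=> xeC; case/negP: (Cind _ _ xC xeC); apply/hamming_adjP.
    by exists ib.
  have /eqP/cards1P[y def_y] := Cdom x xC.
  have : y \in [set y] by rewrite inE.
  rewrite -def_y inE => /andP[yC /hamming_adjP[ib yE]].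
  exists (Some ib); split=> [|[jb|]]; first by rewrite -yE.
    move=> xeC; apply: error_inj; apply: (@addrI _ x); rewrite -yE.
    apply/esym/set1P; rewrite -def_y inE xeC; apply/hamming_adjP.
    by exists jb.
  by rewrite addr0 (negPf xC).
split=> [x y xC yC|x xC].
  apply/negP => /hamming_adjP[ib yE]; have [e [_ eU]] := tile x.
  have := eU None; rewrite addr0 => /(_ xC) eN.
  by have := eU (Some ib); rewrite -yE => /(_ yC); rewrite eN.
have [[ib|] [xeC eU]] := tile x; last by rewrite addr0 (negPf xC) in xeC.
apply/eqP/cards1P; exists (x + error (Some ib)); apply/setP => y.
rewrite !inE; apply/andP/eqP => [[yC /hamming_adjP[jb yE]]|->].
  by rewrite yE; congr (x + error _); apply/esym/eU; rewrite -yE.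
by split=> //; apply/hamming_adjP; exists ib.
Qed.

Lemma sum_syndrome (V : lmodType 'F_3) (f : {linear word n -> V}) x :
  f x = \sum_i x 0 i *: f (delta_mx 0 i).
Proof.
rewrite {1}[x]row_sum_delta linear_sum.
by apply: eq_bigr => i _; rewrite linearZ.
Qed.

End ErrorPatterns.

(** * Codes as preimages of sets of syndromes *)

Section SyndromeCodes.

Variables (n : nat) (V : vectType 'F_3).
Implicit Types (f g : 'Hom(word n, V)) (S : pred V) (C D : code n).

Definition error_syndromes f : V -> Prop := fun v => exists e, f (error e) = v.

Lemma perfect_syndromeP f S C :
    (forall v, exists x, f x = v) -> (forall x, (x \in C) = S (f x)) ->
  perfect_code C <-> forall v, exists! e, S (v + f (error e)).
Proof.
move=> surj CE; rewrite perfect_codeP; split=> tile v.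
  have [x <-] := surj v; have [e [xeC eU]] := tile x; exists e.
  split=> [|e']; first by rewrite -linearD -CE.
  by rewrite -linearD -CE => /eU.
have [e [xeC eU]] := tile (f v); exists e.
by split=> [|e']; rewrite CE linearD // => /eU.
Qed.

(** Each column of [g] is, up to sign, a column of [f], so the two maps differ by a monomial change
    of coordinates; the offset between [t] and [t'] is absorbed by a translation of words. *)
Lemma syndrome_code_equiv f g S t t' C D :
    (forall v, exists x, g x = v) ->
    injective (fun e => g (error e)) ->
    (forall v, error_syndromes g v -> error_syndromes f v) ->
    (forall x, (x \in C) = S (f x - t)) ->
    (forall x, (x \in D) = S (g x - t')) ->
  code_equiv C D.
Proof.
move=> surj g_inj gf CE DE.
have /fin_all_exists[m gE] i : exists jb : 'I_n * bool,
    g (delta_mx 0 i) = (-1) ^+ jb.2 *: f (delta_mx 0 jb.1).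
  have /gf[[[j b]|] fgi] : error_syndromes g (g (error (Some (i, false)))).
  - by exists (Some (i, false)).
  - by exists (j, b); move: fgi; rewrite /= expr0 scale1r linearZ.
  (* A column of [g] cannot be 0, as it would coincide with the syndrome of the zero word. *)
  have := g_inj (Some (i, false)) None.
  by rewrite -fgi /= !linear0 => /(_ erefl).
(* Two columns of [g] coming from the same column of [f] would agree up to the sign [b], giving two
   errors with one syndrome. *)
have m_inj : injective (fun i => (m i).1).
  move=> i j mij; pose b := (m i).2 (+) (m j).2.
  suff /g_inj[] : g (error (Some (i, false))) = g (error (Some (j, b))) by [].
  rewrite /= expr0 scale1r linearZ /= !gE mij scalerA -signr_addb.
  by rewrite -addbA addbb addbF.
have [w gw] := surj (t' - t).
have p_inj i : injective (fun z : 'F_3 => (-1) ^+ (m i).2 * z + w 0 i).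
  by move=> z z' /addIr; apply/mulfI/signr_F3_neq0.
pose s := perm m_inj; pose p i := perm (@p_inj i); exists s, p.
have autE x : g (hamming_aut s p x) - t' = f x - t.
  have -> : hamming_aut s p x = \row_i ((-1) ^+ (m i).2 * x 0 (m i).1) + w.
    by apply/rowP => i; rewrite !mxE !permE.
  rewrite linearD /= gw addrA addrAC addrK; congr (_ - t).
  rewrite !sum_syndrome [RHS](reindex_inj m_inj); apply: eq_bigr => i _.
  by rewrite mxE /= gE scalerA mulrAC -expr2 sqrr_sign mul1r.
have aut_inj : injective (hamming_aut s p).
  move=> x y /rowP xy; apply/rowP => i; have := xy ((s^-1)%g i).
  by rewrite !mxE permKV => /perm_inj.
have [aut' autK' aut'K] := injF_bij aut_inj.
apply/setP=> y; rewrite -[y]aut'K mem_imset // CE DE autE //.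
Qed.

(** The periods of [C] are the words whose syndrome is a period of [S]. *)
Lemma code_kernel_syndrome f S C :
    (forall v, exists x, f x = v) -> (forall x, (x \in C) = S (f x)) ->
    (forall u, (forall v, S (u + v) = S v) -> u = 0) ->
  code_kernel C = lker f.
Proof.
move=> surj CE aperiodic; apply/vspaceP => x; rewrite mem_code_kernel memv_ker.
rewrite inE; apply/eqP/eqP => [xC|fx0].
  apply: aperiodic => v; have [y <-] := surj v.
  by rewrite -linearD -!CE -{1}xC (mem_imset _ _ (addrI x)).
apply/setP => y; rewrite -[y](subrKC x) (mem_imset _ _ (addrI x)) !CE.
by rewrite [X in _ = S X]linearD /= fx0 add0r.
Qed.

(** [C] is a union of cosets of its kernel, hence the full preimage of its image; a nonzero period
    of the image would lift to a period of [C] outside the kernel. *)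
Lemma code_kernel_syndromes f C :
    (forall v, exists x, f x = v) -> lker f = code_kernel C ->
  (forall x, (x \in C) = (f x \in [seq f y | y in C])) /\
  (forall u, (forall v, (u + v \in [seq f y | y in C])
                        = (v \in [seq f y | y in C])) -> u = 0).
Proof.
move=> surj kerE.
have CE x : (x \in C) = (f x \in [seq f y | y in C]).
  apply/idP/imageP => [xC|[y yC fxy]]; first by exists x.
  have : x - y \in code_kernel C.
    by rewrite -kerE memv_ker linearB /= fxy subrr.
  rewrite mem_code_kernel inE => /eqP xyC.
  by rewrite -[x](subrK y) -xyC mem_imset //; apply: addrI.
split=> // u Su; have [x fx] := surj u.
suff : x \in code_kernel C by rewrite -kerE memv_ker fx => /eqP.
rewrite mem_code_kernel inE; apply/eqP/setP => y.
rewrite -[y](subrKC x) (mem_imset _ _ (addrI x)) CE [RHS]CE.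
rewrite [X in _ = (X \in _)]linearD /=.
by rewrite fx Su.
Qed.

End SyndromeCodes.

Notation syndrome := (('F_3)^o * ('F_3)^o * (('F_3)^o * ('F_3)^o))%type.

Lemma scaleF3_triple (V : lmodType 'F_3) (v : V) : v + v = - v.
Proof.
apply/eqP; rewrite -subr_eq0 opprK -[v]scale1r -!scalerDl.
by rewrite (_ : 1 + 1 + 1 = 0) ?scale0r //; apply/eqP.
Qed.

(** If the differences were dependent, the three distinct points would form an affine line over F_3,
    with [s1 - s0] as a period. *)
Lemma free_aperiodic_triple (V : vectType 'F_3) (s0 s1 s2 : V) :
    uniq [:: s0; s1; s2] ->
    (forall u, (forall v, (u + v \in [:: s0; s1; s2])
                          = (v \in [:: s0; s1; s2])) -> u = 0) ->
  free [:: s1 - s0; s2 - s0].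
Proof.
rewrite /= !inE negb_or => /and3P[/andP[s01 s02] s12 _] aperiodic.
rewrite free_cons seq1_free subr_eq0 (eq_sym s2) s02 andbT span_seq1.
apply/vlineP => -[k s10]; case: (F3P k) s10 => ->.
- by move/eqP; rewrite scale0r subr_eq0 eq_sym (negPf s01).
- by rewrite scale1r => /addIr/eqP; rewrite (negPf s12).
rewrite scaleN1r => /eqP; rewrite eq_sym eqr_oppLR => /eqP s20.
suff /aperiodic/eqP : forall v, (s1 - s0 + v \in [:: s0; s1; s2])
                               = (v \in [:: s0; s1; s2]).
  by rewrite subr_eq0 eq_sym (negPf s01).
move=> v; have -> : s2 = s0 - (s1 - s0) by rewrite -s20 subrKC.
move: (s1 - s0) (subrKC s0 s1) => a <-; rewrite !inE.
have -> : (a + v == s0) = (v == s0 - a).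
  by rewrite [RHS]eq_sym subr_eq eq_sym addrC.
have -> : (a + v == s0 - a) = (v == s0 + a).
  by rewrite -scaleF3_triple addrCA (addrC s0) (inj_eq (addrI a)) addrC.
by rewrite (addrC s0 a) (inj_eq (addrI a)) orbC -orbA.
Qed.

(** * Tilings of F_3^4 by a triple *)

Section Tiling.

Variables (n : nat) (V : vectType 'F_3) (f : 'Hom(word n, V)).

Lemma error_syndromesN v : error_syndromes f v -> error_syndromes f (- v).
Proof.
case=> e <-; have [e' e'E] := errorN e.
by exists e'; rewrite e'E linearN.
Qed.

Variable S : pred V.
Hypothesis tile : forall v, exists! e, S (v + f (error e)).

(** The point [s - v] reaches both [s] and [s'] by adding elements of E, so uniqueness identifies
    them: E and S share no nonzero difference. *)
Lemma tiling_disjoint v s s' :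
    error_syndromes f v -> error_syndromes f (v + (s' - s)) -> S s -> S s' ->
  s = s'.
Proof.
case=> [e <-] [e' fe'] sS s'S; have [e0 [_ e0U]] := tile (s - f (error e)).
have e0e : e0 = e by apply: e0U; rewrite subrK.
have e0e' : e0 = e' by apply: e0U; rewrite fe' addrA subrK subrKC.
move/eqP: fe'; rewrite -e0e -e0e' -subr_eq0 opprD addrA subrr add0r oppr_eq0.
by rewrite subr_eq0 => /eqP.
Qed.

Lemma tiling_error_inj : injective (fun e => f (error e)).
Proof.
move=> e e' eqf; have [e0 [Se0 _]] := tile 0; rewrite add0r in Se0.
have [e1 [_ e1U]] := tile (f (error e0) - f (error e)).
by rewrite -[e]e1U ?subrK // -[e']e1U // -eqf subrK.
Qed.

Lemma tiling_cover v : exists2 s, S s & error_syndromes f (v - s).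
Proof.
have [e [Se _]] := tile v; exists (v + f (error e)) => //.
by rewrite opprD addrA subrr add0r; apply: error_syndromesN; exists e.
Qed.

End Tiling.

(** Subtracting error syndromes from elements of [S] gives a bijection from pairs onto the 81
    vectors. *)
Lemma tiling_card n (f : 'Hom(word n, syndrome)) (S : pred syndrome) :
    (forall v, exists! e, S (v + f (error e))) ->
  (#|S| * (n * 2).+1 = 81)%N.
Proof.
move=> tile;
pose F (se : syndrome * option ('I_n * bool)) := se.1 - f (error se.2).
have F_inj : {in setX [set s | S s] setT &, injective F}.
  move=> [s e] [s' e']; rewrite !inE /= !andbT => Ss Ss' eqF.
  have [e0 [_ e0U]] := tile (F (s, e)).
  have e0e : e0 = e by apply: e0U; rewrite /F /= subrK.
  have e0e' : e0 = e' by apply: e0U; rewrite eqF /F /= subrK.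
  by move: eqF; rewrite /F /= -e0e -e0e' => /addIr->.
have := card_in_imset F_inj.
rewrite cardsX cardsT card_option card_prod card_ord card_bool cardsE => <-.
rewrite (_ : F @: _ = setT) ?cardsT ?card_prod ?card_Fp //.
apply/setP => v; rewrite !inE; apply/imsetP; have [e [Se _]] := tile v.
by exists (v + f (error e), e); rewrite /F /= ?addrK ?inE //= Se.
Qed.

(* The translate by -t of S, in a basis whose last two vectors are a, a + b. *)
Definition corner : seq syndrome := [:: 0; ((0, 0), (1, 0)); ((0, 0), (-1, 1))].

(** * The error set of a tiling by the corner is a graph *)

Section CornerTiling.

Variables (n : nat) (f : 'Hom(word n, syndrome)).
Hypothesis tile : forall v, exists! e, v + f (error e) \in corner.

Let ea : syndrome := ((0, 0), (1, 0)).
Let eb : syndrome := ((0, 0), (-1, 1)).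
Let E := error_syndromes f.

Let Ediff v s s' : E v -> E (v + (s' - s)) -> s \in corner -> s' \in corner ->
  s = s'.
Proof. exact: (tiling_disjoint (S := fun v => v \in corner)). Qed.

Let Ecover v : exists2 s, s \in corner & E (v - s).
Proof. exact: (tiling_cover (S := fun v => v \in corner)). Qed.

(** The shift is a + b, with a, b the nonzero corner points [ea], [eb]. If v + a + b were covered by
    a or by b, then v + b or v + a would lie in E, a forbidden difference from v; so it is covered
    by 0. *)
Let Eperiod v : E v -> E (v + ((0, 0), (0, 1))).
Proof.
move=> Ev; have [s] := Ecover (v + ((0, 0), (0, 1))); rewrite !inE.
case/or3P => /eqP->; first by rewrite subr0.
- have -> : v + ((0, 0), (0, 1)) - ((0, 0), (1, 0)) = v + (eb - 0).
    by rewrite -addrA; congr (v + _); apply/eqP.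
  by move/(Ediff Ev); rewrite !inE !eqxx !orbT => /(_ isT isT).
have -> : v + ((0, 0), (0, 1)) - ((0, 0), (-1, 1)) = v + (ea - 0).
  by rewrite -addrA; congr (v + _); apply/eqP.
by move/(Ediff Ev); rewrite !inE !eqxx !orbT => /(_ isT isT).
Qed.

Let Eperiodic x w z z' : E (x, (w, z)) -> E (x, (w, z')).
Proof.
have step y : E (x, (w, y)) -> E (x, (w, y + 1)).
  move/Eperiod; congr E; case: x => x1 x2.
  by congr (_, _, (_, _)); rewrite ?addr0.
rewrite -(subrKC z z'); case: (F3P (z' - z)) => ->; rewrite ?addr0 //.
  exact: step.
by move=> /step/step; rewrite -addrA (_ : 1 + 1 = -1) //; apply/eqP.
Qed.

(** Distinct values of the third coordinate would make E contain the forbidden difference a or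
    -a. *)
Let Efunctional x w w' z : E (x, (w, z)) -> E (x, (w', z)) -> w = w'.
Proof.
move=> Ew; rewrite -(subrKC w w'); case: (F3P (w' - w)) => ->.
- by rewrite addr0.
- have -> : (x, (w + 1, z)) = (x, (w, z)) + (ea - 0) :> syndrome.
    case: x {Ew} => x1 x2; rewrite subr0.
    by congr (_, _, (_, _)); rewrite /= ?addr0.
  by move/(Ediff Ew); rewrite !inE !eqxx !orbT => /(_ isT isT).
have -> : (x, (w - 1, z)) = (x, (w, z)) + (0 - ea) :> syndrome.
  case: x {Ew} => x1 x2; rewrite sub0r.
  by congr (_, _, (_, _)); rewrite /= ?oppr0 ?addr0.
by move/(Ediff Ew); rewrite !inE !eqxx !orbT => /(_ isT isT).
Qed.

Lemma corner_tiling_graph : exists w : 'F_3 -> 'F_3 -> 'F_3,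
  forall x y c z, E ((x, y), (c, z)) <-> c = w x y.
Proof.
have /fin_all_exists[w wE] (x : 'F_3 * 'F_3) : exists w : 'F_3, E (x, (w, 0)).
  case: x => x1 x2.
  have [[[s1 s2] [s3 s4]] sS Es] := Ecover ((x1, x2), (0, 0)).
  (* Corner points vanish in the first two coordinates, so the covering element of E still lies over
     [(x1, x2)]. *)
  exists (- s3); apply: Eperiodic (0 - s4) _ _; move: Es; congr E.
  have [-> ->] : s1 = 0 /\ s2 = 0.
    by move: sS; rewrite !inE => /or3P[] /eqP[-> ->].
  by congr (_, _, (_, _)); rewrite /= ?oppr0 ?addr0 ?add0r.
exists (fun x y => w (x, y)) => x y c z; split=> [Ec|->].
  exact: Efunctional (Eperiodic 0 Ec) (wE _).
exact: Eperiodic (wE _).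
Qed.

End CornerTiling.

(** An odd function is determined by its values at (1,0), (0,1), (1,1) and (1,-1), as many as there
    are coefficients. *)
Lemma F3_odd_cubic (w : 'F_3 -> 'F_3 -> 'F_3) :
    (forall x y, w (- x) (- y) = - w x y) ->
  exists p q r s, forall x y,
    w x y = p * x ^+ 2 * y + q * x * y ^+ 2 + r * x + s * y.
Proof.
move=> oddw; pose r := w 1 0; pose s := w 0 1.
(* Interpolation: w(1,1) + w(1,-1) = 2(q + r) = -(q + r), and w(1,1) = p + q + r + s. *)
pose q := - (w 1 1 + w 1 (-1)) - r; pose p := w 1 1 - q - r - s.
exists p, q, r, s => x y.
have w00 : w 0 0 = 0.
  by have := oddw 0 0; rewrite oppr0; case: (F3P (w 0 0)) => -> // /eqP.
have wN0 : w (-1) 0 = - w 1 0 by have := oddw 1 0; rewrite oppr0.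
have w0N : w 0 (-1) = - w 0 1 by have := oddw 0 1; rewrite oppr0.
have wNN : w (-1) (-1) = - w 1 1 by rewrite oddw.
have wN1 : w (-1) 1 = - w 1 (-1) by rewrite -oddw opprK.
by rewrite /p /q /r /s; case: (F3P x) => ->; case: (F3P y) => ->;
   rewrite ?w00 ?wN0 ?w0N ?wNN ?wN1;
   case: (F3P (w 1 1)) => ->; case: (F3P (w 1 (-1))) => ->;
   case: (F3P (w 1 0)) => ->; case: (F3P (w 0 1)) => ->; apply/eqP.
Qed.

(** * Normal form *)

Section Shear.

Variables a b c d r s : 'F_3.

(** Acts on the base (x, y) of the surface and adds a linear form to its height, while fixing every
    vector over (0, 0), in particular the corner. *)
Definition shear (v : syndrome) : syndrome :=
  ((a * v.1.1 + b * v.1.2, c * v.1.1 + d * v.1.2),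
   (v.2.1 + r * v.1.1 + s * v.1.2, v.2.2)).

Lemma shear_is_linear : linear shear.
Proof.
move=> k [[x y] [w z]] [[x' y'] [w' z']]; rewrite /shear /=.
by congr (_, _, (_, _)); rewrite /= /GRing.scale /=; ring.
Qed.

HB.instance Definition _ :=
  GRing.isLinear.Build 'F_3 syndrome syndrome _ shear shear_is_linear.

Lemma shear_inj :
    (forall x y, a * x + b * y = 0 -> c * x + d * y = 0 -> x = 0 /\ y = 0) ->
  injective shear.
Proof.
move=> inj; suff ker v : shear v = 0 -> v = 0.
  move=> u v uv; apply/eqP; rewrite -subr_eq0; apply/eqP/ker.
  by rewrite linearB /= uv subrr.
case: v => [[x y] [w z]] sv0.
have [x0 y0] : x = 0 /\ y = 0.
  by apply: inj; [move/(congr1 (fun v => v.1.1)): sv0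
                | move/(congr1 (fun v => v.1.2)): sv0].
have /= w0 := congr1 (fun v => v.2.1) sv0.
have /= z0 := congr1 snd (congr1 snd sv0).
by move: w0 z0; rewrite x0 y0 !mulr0 !addr0 => -> ->.
Qed.

End Shear.

Lemma F3_binary_cubic (p q : 'F_3) : (p != 0) || (q != 0) ->
  exists a b c d k : 'F_3,
    (forall x y, (a * x + b * y) ^+ 2 * (c * x + d * y)
                 = p * x ^+ 2 * y + q * x * y ^+ 2 + k * y) /\
    (forall x y, a * x + b * y = 0 -> c * x + d * y = 0 -> x = 0 /\ y = 0).
Proof.
have [-> /= q0|p0 _] := eqVneq p 0.
  exists 0, 1, q, 0, 0; split=> x y; first by ring.
  rewrite !mul0r mul1r add0r addr0 => -> /eqP.
  by rewrite mulf_eq0 (negPf q0) => /eqP.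
(* Completing the square: since p^2 = 1, (x - pqy)^2 py = px^2y + qxy^2 + pq^2y^3, and y^3 = y turns
   the last term into a linear form. *)
exists 1, (- (p * q)), 0, p, (p * q ^+ 2); split=> x y.
  case: (F3P p) p0 => -> // _; case: (F3P q) => ->;
  by case: (F3P x) => ->; case: (F3P y) => ->; apply/eqP.
rewrite mul1r mul0r add0r => + /eqP.
by rewrite mulf_eq0 (negPf p0) => /[swap] /eqP->; rewrite mulr0 addr0.
Qed.

Definition normal_form n (f : 'Hom(word n, syndrome)) t (C : code n) : Prop :=
  [/\ forall v, exists x, f x = v,
      injective (fun e => f (error e)),
      forall v, error_syndromes f v <-> v.2.1 = v.1.1 ^+ 2 * v.1.2
    & forall x, (x \in C) = (f x - t \in corner)].

Lemma exists_unique_shift (V : zmodType) (T : Type) (h : T -> V)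
    (S : pred V) t :
    (forall v, exists! e, S (v + h e - t)) ->
  forall v, exists! e, S (v + h e).
Proof.
move=> tile v; have [e [Se eU]] := tile (v + t); exists e.
by split=> [|e' Se']; [move: Se | apply: eU]; rewrite addrAC addrK.
Qed.

Lemma corner_code_normal_form n (f : 'Hom(word n, syndrome)) t (C : code n) :
    (forall v, exists x, f x = v) ->
    (forall x, (x \in C) = (f x - t \in corner)) ->
    perfect_code C ->
  exists f' t', normal_form f' t' C.
Proof.
move=> surj CE Cperfect.
have tile : forall v, exists! e, v + f (error e) \in corner.
  apply: (exists_unique_shift (t := t)).
  by apply/(perfect_syndromeP (S := fun v => v - t \in corner) surj CE).
have f_inj := tiling_error_inj (S := fun v => v \in corner) tile.
have [w wE] := corner_tiling_graph tile.
have oddw x y : w (- x) (- y) = - w x y.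
  have /error_syndromesN : error_syndromes f ((x, y), (w x y, 0)) by apply/wE.
  by move/wE.
have [p [q [r [s wpqrs]]]] := F3_odd_cubic oddw.
(* Otherwise all columns of [f] lie in the hyperplane [on_plane], contradicting surjectivity. *)
have pq_neq0 : (p != 0) || (q != 0).
  rewrite -negb_and; apply/negP => /andP[/eqP p0 /eqP q0].
  pose on_plane (v : syndrome) := v.2.1 = r * v.1.1 + s * v.1.2.
  have planeP x : on_plane (f x).
    rewrite sum_syndrome /=; apply: (big_ind on_plane) => [|u v|i _].
    - by rewrite /on_plane !mulr0 addr0.
    - by rewrite /on_plane /= => -> ->; rewrite !mulrDr addrACA.
    have : error_syndromes f (f (delta_mx 0 i)).
      by exists (Some (i, false)); rewrite /= expr0 scale1r.
    rewrite /on_plane; case: (f _) => [[y z] [c d]] /wE -> /=.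
    rewrite wpqrs p0 q0.
    by rewrite /GRing.scale /=; ring.
  have [x fx] := surj ((0, 0), (1, 0)).
  by have := planeP x; rewrite fx /on_plane /= !mulr0 addr0 => /eqP.
have [a [b [c [d [k [abcd inj]]]]]] := F3_binary_cubic pq_neq0.
(* The terms [- r] and [- s] cancel the linear part of [w]; [k] supplies the linear form left over
   by the reduction of the cubic. *)
pose sh := shear a b c d (- r) (k - s).
have sh_inj : injective sh := shear_inj inj.
have [sh' shK sh'K] := injF_bij sh_inj.
pose g := linfun sh; have gE v : g v = sh v by rewrite lfunE.
have sh_corner v : (sh v \in corner) = (v \in corner).
  rewrite -[RHS](mem_map sh_inj) (_ : map sh corner = corner) //.
  have sh0 : sh 0 = 0 by rewrite /sh linear0.
  rewrite /corner !map_cons sh0; congr [:: _, _, _ & _];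
  by congr (_, _, (_, _)); rewrite /= !mulr0 ?addr0.
exists (g \o f)%VF, (sh t); split=> [v|e e'|[[x y] [u z]]|x].
- by have [x fx] := surj (sh' v); exists x; rewrite comp_lfunE gE fx sh'K.
- by rewrite /= !comp_lfunE !gE => /sh_inj/f_inj.
- have -> : error_syndromes (g \o f)%VF (x, y, (u, z)) <->
            error_syndromes f (sh' (x, y, (u, z))).
    split=> -[e eE]; exists e; last by rewrite comp_lfunE gE eE sh'K.
    by rewrite -eE comp_lfunE gE shK.
  rewrite -[in X in _ <-> X](sh'K (x, y, (u, z))).
  case: (sh' _) => [[x' y'] [u' z']]; rewrite wE wpqrs /= abcd; split=> [->|E].
    by ring.
  apply: (@addIr _ (- r * x' + (k - s) * y')); rewrite addrA E; ring.
by rewrite comp_lfunE gE -(linearB (shear _ _ _ _ _ _)) sh_corner.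
Qed.

Lemma perfect_code_normal_form (C : code 13) :
    perfect_code C -> \dim (code_kernel C) = 9%N ->
  exists f t, normal_form f t C.
Proof.
move=> Cperfect dimC.
have [|f0 [kerf0 imf0]]
  := @hom_with_kernel _ (word 13) syndrome (code_kernel C).
  by rewrite dimC !dimvf.
have surj0 v : exists x, f0 x = v.
  have : v \in limg f0 by rewrite imf0 memvf.
  by case/memv_imgP => x _ ->; exists x.
have [CE aperiodic] := code_kernel_syndromes surj0 kerf0.
pose S : pred syndrome := fun v => v \in [seq f0 y | y in C].
have /(perfect_syndromeP (S := S) surj0 CE) tile := Cperfect.
(* For length 13 there are 27 errors, and 81 = 3 * 27. *)
have /eqP := tiling_card tile; rewrite (eqn_mul2r 27 _ 3) /= => /eqP cardS.
have memS v : S v = (v \in enum S) by rewrite mem_enum.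
move: memS (enum_uniq S) cardS; rewrite cardE.
case: (enum S) => [|s0 [|s1 [|s2 []]]] // memS uniqS _.
have free_ab : free [:: s1 - s0; s2 - s0].
  apply: free_aperiodic_triple => // u Su; apply: aperiodic => v.
  by have := Su v; rewrite -!memS.
have [||g [ga gb] g_inj] := end_of_free free_ab
    (Y := [:: ((0, 0), (1, 0)); ((0, 0), (-1, 1))] : seq syndrome) _ _.
- rewrite free_cons seq1_free span_seq1; apply/andP; split=> //.
  by apply/vlineP => -[k [_ /esym/eqP]]; case: (F3P k) => ->.
- by [].
apply: (@corner_code_normal_form _ (g \o f0)%VF (g s0)) => // [v|x].
  have [g' gK g'K] := injF_bij g_inj; have [x fx] := surj0 (g' v).
  by exists x; rewrite comp_lfunE fx g'K.
rewrite CE -/(S _) memS comp_lfunE -linearB /= /corner -gb -ga -(linear0 g).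
by rewrite !inE !(inj_eq g_inj) !subr_eq add0r !subrK.
Qed.

Lemma normal_form_equiv n f t f' t' (C D : code n) :
  normal_form f t C -> normal_form f' t' D -> code_equiv C D.
Proof.
move=> [_ _ fE CE] [surj f'_inj f'E DE].
apply: (syndrome_code_equiv (S := fun v => v \in corner) surj f'_inj _ CE DE).
by move=> v /f'E/fE.
Qed.

(** * Existence *)

(** Over (0, 0) the corner is a graph z of c, while the cubic surface is a graph of c; this lets
    [cubic_tiling] solve for the error one coordinate at a time. *)
Lemma mem_corner (x y c z : 'F_3) :
  (((x, y), (c, z)) : syndrome) \in corner
    = [&& x == 0, y == 0 & z == (c == -1)%:R].
Proof.
by case: (F3P x) => ->; case: (F3P y) => ->; case: (F3P c) => ->;
   case: (F3P z) => ->; rewrite !inE.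
Qed.

(** A period moves 0 into the corner, so it is a corner point; the double of a nonzero corner point
    is not in the corner. *)
Lemma corner_aperiodic (u : syndrome) :
  (forall v, (u + v \in corner) = (v \in corner)) -> u = 0.
Proof.
move=> uP; have := uP 0; rewrite addr0 [RHS]inE eqxx !inE.
case/or3P=> /eqP u0 //; move: uP; rewrite u0.
- by move/(_ ((0, 0), (1, 0)))/eqP.
- by move/(_ ((0, 0), (-1, 1)))/eqP.
Qed.

(* One vector from each pair {v, -v} of nonzero points of the surface
   {((x, y), (x^2 y, z))}. *)
Definition columns : seq syndrome :=
  [:: ((0, 0), (0, 1));
      ((1, 0), (0, 0)); ((1, 0), (0, 1)); ((1, 0), (0, -1));
      ((0, 1), (0, 0)); ((0, 1), (0, 1)); ((0, 1), (0, -1));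
      ((1, 1), (1, 0)); ((1, 1), (1, 1)); ((1, 1), (1, -1));
      ((1, -1), (-1, 0)); ((1, -1), (-1, 1)); ((1, -1), (-1, -1))].

Definition cubic_syndrome (x : word 13) : syndrome :=
  \sum_(i < 13) x 0 i *: columns`_i.

Lemma cubic_syndrome_is_linear : linear cubic_syndrome.
Proof.
move=> k x y; rewrite /cubic_syndrome scaler_sumr -big_split.
by apply: eq_bigr => i _; rewrite !mxE scalerDl scalerA.
Qed.

HB.instance Definition _ := GRing.isLinear.Build 'F_3 (word 13) syndrome _
  cubic_syndrome cubic_syndrome_is_linear.

Lemma cubic_syndrome_delta i : cubic_syndrome (delta_mx 0 i) = columns`_i.
Proof.
rewrite /cubic_syndrome (bigD1 i) //= mxE !eqxx scale1r big1 ?addr0 // => j ji.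
by rewrite mxE (negPf ji) andbF scale0r.
Qed.

Lemma cubic_error_syndromes v :
  error_syndromes (linfun cubic_syndrome) v <-> v.2.1 = v.1.1 ^+ 2 * v.1.2.
Proof.
split=> [[[[i b]|] <-]|]; rewrite ?lfunE /=.
- rewrite linearZ /= cubic_syndrome_delta; have : columns`_i \in columns.
    by rewrite mem_nth.
  pose on_cubic (u : syndrome) := u.2.1 == u.1.1 ^+ 2 * u.1.2.
  have /allP colP : all on_cubic columns by [].
  move/colP/eqP; case: (columns`_i) => [[x y] [w z]] /= ->.
  by case: b; rewrite /GRing.scale /=; ring.
- by rewrite linear0 /= mulr0.
case: v => [[x y] [w z]] /= ->.
have: [|| (x, y, (x ^+ 2 * y, z)) == 0 :> syndrome,
   ((x, y), (x ^+ 2 * y, z)) \in columns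
 | - (((x, y), (x ^+ 2 * y, z)) : syndrome) \in columns].
  by case: (F3P x) => ->; case: (F3P y) => ->; case: (F3P z) => ->.
case/or3P=> [/eqP->|/(nthP 0)[i ltin vE]|/(nthP 0)[i ltin /esym/eqP]].
- by exists None; rewrite linear0.
- exists (Some (Ordinal (ltin : i < 13)%N, false)).
  by rewrite lfunE /= expr0 scale1r cubic_syndrome_delta.
rewrite eqr_oppLR => /eqP vE; exists (Some (Ordinal (ltin : i < 13)%N, true)).
by rewrite lfunE /= expr1 scaleN1r linearN /= cubic_syndrome_delta.
Qed.

(** By counting: the coordinates x, y, z parametrize the surface, so the 27 errors map onto the 27
    triples. *)
Lemma cubic_error_inj :
  injective (fun e => let v := linfun cubic_syndrome (error e) in
                      (v.1.1 : 'F_3, v.1.2 : 'F_3, v.2.2 : 'F_3)).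
Proof.
move: (linfun _) cubic_error_syndromes => f fE.
pose h e : 'F_3 * 'F_3 * 'F_3 :=
  ((f (error e)).1.1, (f (error e)).1.2, (f (error e)).2.2).
suff /image_injP hinj : #|[seq h e | e in predT]|
                         == #|{: option ('I_13 * bool)}|.
  by move=> e e' eqh; apply: hinj.
rewrite [X in X == _](_ : _ = #|{: 'F_3 * 'F_3 * 'F_3}|).
  by rewrite card_option !card_prod !card_Fp // card_ord card_bool.
apply: eq_card => -[[x y] z]; rewrite [RHS]inE; apply/imageP.
have /fE[e fe] : ((x, y), (x ^+ 2 * y, z)).2.1
               = ((x, y), (x ^+ 2 * y, z) : ('F_3)^o * ('F_3)^o).1.1 ^+ 2 * y.
  by [].
by exists e; rewrite // /h fe.
Qed.

Lemma cubic_tiling v :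
  exists! e, v + linfun cubic_syndrome (error e) \in corner.
Proof.
move: (linfun _) cubic_error_syndromes cubic_error_inj => f fE f_inj.
case: v => [[x y] [w z]].
(* The error must have base (-x, -y), hence height -x^2y; the sum then has third coordinate w -
   x^2y, which fixes the last one. *)
pose z' : 'F_3 := (w - x ^+ 2 * y == -1)%:R - z.
have memE e : ((x, y), (w, z)) + f (error e) \in corner <->
    ((f (error e)).1.1 : 'F_3, (f (error e)).1.2 : 'F_3,
     (f (error e)).2.2 : 'F_3)
    = (- x, - y, z').
  have : error_syndromes f (f (error e)) by exists e.
  case: (f _) => [[x1 y1] [w1 z1]] /fE /= ->.
  rewrite mem_corner addr_eq0 (addr_eq0 y).
  rewrite -[x == _]eqr_oppLR -[y == _]eqr_oppLR.
  rewrite /=; split=> [/and3P[/eqP <- /eqP <- /eqP z1E]|[-> -> ->]]; last first.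
    by rewrite !eqxx /z' sqrrN mulrN subrKC eqxx.
  by congr (_, _, _); rewrite /z' -[z1](addKr z) z1E sqrrN mulrN addrC.
have /fE[e fe] : ((- x, - y), ((- x) ^+ 2 * - y, z')).2.1
     = ((- x, - y), ((- x) ^+ 2 * - y, z') : ('F_3)^o * ('F_3)^o).1.1 ^+ 2 * - y.
  by [].
exists e; split=> [|e' /memE e'E]; first by apply/memE; rewrite fe.
by apply: f_inj; rewrite /= e'E fe.
Qed.

Lemma cubic_syndrome_surj v : exists x, linfun cubic_syndrome x = v.
Proof.
case: v => [[x y] [w z]]; pose e i : word 13 := delta_mx 0 (inord i).
have fe i : (i < 13)%N -> cubic_syndrome (e i) = columns`_i.
  by move=> lti; rewrite cubic_syndrome_delta inordK.
(* Column 7 is ((1,1),(1,0)) and supplies [w]; columns 1, 4 and 0 are unit vectors, the first two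
   also correcting its effect on x and y. *)
exists ((x - w) *: e 1%N + (y - w) *: e 4%N + w *: e 7%N + z *: e 0%N).
rewrite lfunE !linearD !linearZ /= !fe //.
by congr (_, _, (_, _)); rewrite /= /GRing.scale /=; ring.
Qed.

Lemma perfect_code_kernel9 :
  exists C : code 13, perfect_code C /\ \dim (code_kernel C) = 9%N.
Proof.
pose f := linfun cubic_syndrome; pose C : code 13 := [set x | f x \in corner].
have CE x : (x \in C) = (f x \in corner) by rewrite inE.
have surj : forall v, exists x, f x = v := cubic_syndrome_surj.
exists C; split.
  apply/(perfect_syndromeP (S := fun v => v \in corner) surj CE).
  exact: cubic_tiling.
rewrite (code_kernel_syndrome surj CE corner_aperiodic).
have limf : limg f = fullv.
  apply/eqP; rewrite eqEsubv subvf; apply/subvP => v _.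
  by have [x <-] := surj v; rewrite memv_img ?memvf.
by apply/eqP; rewrite -(eqn_add2r (\dim (limg f))) -{1}(capfv (lker f))
   limg_ker_dim limf !dimvf.
Qed.

Theorem theorem4 :
  (exists C : code 13, perfect_code C /\ \dim (code_kernel C) = 9%N) /\
  (forall C D : code 13,
     perfect_code C -> \dim (code_kernel C) = 9%N ->
     perfect_code D -> \dim (code_kernel D) = 9%N ->
     code_equiv C D).
Proof.
split=> [|C D Cperfect dimC Dperfect dimD]; first exact: perfect_code_kernel9.
have [f [t Cf]] := perfect_code_normal_form Cperfect dimC.
have [g [u Dg]] := perfect_code_normal_form Dperfect dimD.
exact: normal_form_equiv Cf Dg.
Qed.
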